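(* There exists an ultrametric space $(X,u)$ with $X$ countable and with a countable partially ordered value set, such that its ultrametric ball space $(X,\mathcal{B}_u)$ is spherically complete, but there is no ball space $(X,\mathcal{B}')$ with $\mathcal{B}_u\subseteq\mathcal{B}'$ (that is, no expansion of $(X,\mathcal{B}_u)$) that is both chain union closed and spherically complete.
   Context: A ball space $(X,\mathcal{B})$ is a nonempty set $X$ together with a nonempty collection $\mathcal{B}$ of nonempty subsets of $X$ (called balls). A chain in $\mathcal{B}$ is a nonempty subset of $\mathcal{B}$ that is linearly ordered by inclusion. The ball space is spherically complete if every chain in $\mathcal{B}$ has nonempty intersection, and chain union closed if the union of every chain in $\mathcal{B}$ is a member of $\mathcal{B}$. A ball space $(X,\mathcal{B}')$ is an expansion of $(X,\mathcal{B})$ if $\mathcal{B}\subseteq\mathcal{B}'$. An ultrametric space $(X,u)$ with value set $\Gamma$ consists of a nonempty set $X$, a partially ordered set $\Gamma$ with smallest element $\bot$, and a function $u:X\times X\to\Gamma$ such that for all $x,y,z\in X$, $\gamma\in\Gamma$: (U1) $u(x,y)=\bot$ iff $x=y$; (U2) if $u(x,y)\le\gamma$ and $u(y,z)\le\gamma$ then $u(x,z)\le\gamma$; (U3) $u(x,y)=u(y,x)$. For $x,y\in X$, the (precise) ball is $B(x,y)=\{z\in X\mid u(x,z)\le u(x,y)\}$. The ultrametric ball space is $(X,\mathcal{B}_u)$ with $\mathcal{B}_u=\{B(x,y)\mid x,y\in X\}$. An ultrametric space is called spherically complete if its ultrametric ball space is. *)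

(* Defs.v *)
From HB Require Import structures.
From mathcomp Require Import all_boot all_order.
From mathcomp Require Import boolp classical_sets functions cardinality.

Set Implicit Arguments.
Unset Strict Implicit.
Unset Printing Implicit Defensive.

Local Open Scope classical_set_scope.
Local Open Scope order_scope.

Section BallSpaces.
Variable X : Type.
Implicit Types B C : set (set X).

Definition ball_space B : Prop :=
  [/\ [set: X] !=set0, B !=set0 & forall b, B b -> b !=set0].

Definition chain_in B C : Prop :=
  [/\ C !=set0, C `<=` B & total_on C (@subset X)].

Definition spherically_complete B : Prop :=
  forall C, chain_in B C -> \bigcap_(b in C) b !=set0.

Definition chain_union_closed B : Prop :=
  forall C, chain_in B C -> B (\bigcup_(b in C) b).

Definition expansion B (B' : set (set X)) : Prop :=
  ball_space B' /\ B `<=` B'.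

End BallSpaces.

Section UltrametricSpaces.
Context {d : Order.disp_t} {Gamma : bPOrderType d} {X : Type}.
Implicit Types (u : X -> X -> Gamma) (x y z : X) (g : Gamma).

Record ultrametric_space u : Prop := {
  ultrametric_nonempty : [set: X] !=set0;
  ultrametric_bot : forall x y, u x y = \bot <-> x = y;
  ultrametric_trans : forall x y z g,
    u x y <= g -> u y z <= g -> u x z <= g;
  ultrametric_sym : forall x y, u x y = u y x
}.

Definition uball u x y : set X := [set z | u x z <= u x y].

Definition uballs u : set (set X) := [set b | exists x y, b = uball u x y].

Lemma uballs_ball_space u : ultrametric_space u -> ball_space (uballs u).
Proof.
move=> uX; split; first exact: ultrametric_nonempty uX.
- by have [x _] := ultrametric_nonempty uX; exists (uball u x x), x, x.
- by move=> _ [x [y ->]]; exists y => /=; exact: Order.POrderTheory.lexx.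
Qed.

End UltrametricSpaces.

(* Main.v *)
(** On [nat], let [u x y] be the set of unit steps [i, i+1] crossed when going
    from [x] to [y]; the balls are then exactly the bounded intervals.  They are
    finite, so a chain of balls has a smallest member.  But each ray [n, oo) is
    the union of the chain of the intervals [n, m], and the rays form a chain
    with empty intersection. *)
From HB Require Import structures.
Require Import Defs.
From mathcomp Require Import all_boot all_order.
From mathcomp Require Import finmap zify.
From mathcomp Require Import boolp classical_sets functions cardinality.

Local Open Scope classical_set_scope.

Section FsetInclusionOrder.
Variable K : choiceType.

Lemma fsubset_antisym : antisymmetric (@fsubset K).
Proof. by move=> A B AB; apply/eqP; rewrite eqEfsubset. Qed.

HB.instance Definition _ := Order.Le_isPOrder.Build (Order.Disp tt tt) {fset K}
  (@fsubset_refl K) fsubset_antisym (@fsubset_trans K).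

HB.instance Definition _ :=
  Order.hasBottom.Build (Order.Disp tt tt) {fset K} (@fsub0set K).

End FsetInclusionOrder.

(** The number [i] encodes the step from [i] to [i + 1], hence the right end is excluded. Values are
    finite sets, ordered by inclusion, so that the value set is countable. *)
Definition steps (x y : nat) : {fset nat} :=
  [fset i | i in iota (minn x y) (maxn x y - minn x y)]%fset.

Definition segment (a b : nat) : set nat := [set z | a <= z <= b].

Lemma in_steps (x y i : nat) : (i \in steps x y) = (minn x y <= i < maxn x y).
Proof. by rewrite in_fset /= mem_iota subnKC // geq_min leq_max leqnn. Qed.

Lemma steps_le (x y : nat) (g : {fset nat}) :
  (steps x y <= g)%O <-> forall i, minn x y <= i < maxn x y -> i \in g.
Proof.
split=> [/fsubsetP sg i|sg].
  by rewrite -in_steps; exact: sg.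
by apply/fsubsetP => i; rewrite in_steps; exact: sg.
Qed.

(** For (U2), each step crossed between [x] and [z] is crossed between [x] and [y] or between [y]
    and [z]. *)
Lemma steps_ultrametric : ultrametric_space steps.
Proof.
split.
- by exists 0.
- move=> x y; split=> [sxy0|<-].
    have /steps_le/(_ (minn x y)) : (steps x y <= \bot)%O by rewrite sxy0.
    by rewrite in_fset0; lia.
  apply/fsetP => i.
  by rewrite in_steps in_fset0; lia.
- move=> x y z g /steps_le sxy /steps_le syz; apply/steps_le => i xiz.
  have [xiy|yiz] : minn x y <= i < maxn x y \/ minn y z <= i < maxn y z by lia.
    exact: sxy.
  exact: syz.
- by move=> x y; apply/fsetP => i; rewrite !in_steps; lia.
Qed.

Lemma uball_steps (x y : nat) :
  uball steps x y = segment (minn x y) (maxn x y).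
Proof.
apply/seteqP; split=> z; rewrite /uball /segment /=.
  move/steps_le=> xzy; apply/negP => /negP nz.
  (* For [z] outside the segment, the step adjacent to [z] on the side of [x] is crossed towards [z]
     but not towards [y]. In the second case [z] is positive, so [z.-1] is a true predecessor. *)
  have := xzy (if z < x then z else z.-1).
  by rewrite in_steps; case: ifP => zx; lia.
by move=> zxy; apply/steps_le => i; rewrite in_steps; lia.
Qed.

(** The form [a + k] excludes empty segments and exposes the length [k], which is minimised over a
    chain below. *)
Lemma uballs_stepsP (b : set nat) :
  uballs steps b <-> exists a k, b = segment a (a + k).
Proof.
split=> [[x [y ->]]|[a [k ->]]].
  exists (minn x y), (maxn x y - minn x y).
  by rewrite uball_steps; congr segment; lia.
by exists a, (a + k); rewrite uball_steps; congr segment; lia.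
Qed.

Lemma segment_subset (a b c e : nat) :
  a <= b -> segment a b `<=` segment c e <-> c <= a /\ b <= e.
Proof.
move=> ab; split=> [sub|[ca be] z]; last by rewrite /segment /=; lia.
have := sub a; have := sub b; rewrite /segment /= !leqnn ab.
by move=> /(_ isT) ? /(_ isT); lia.
Qed.

Lemma steps_spherically_complete : spherically_complete (uballs steps).
Proof.
move=> C [[b0 Cb0] Cballs Ctot].
have exk : exists k, `[< exists a, C (segment a (a + k)) >].
  have /uballs_stepsP[a [k b0E]] := Cballs _ Cb0.
  by exists k; apply/asboolP; exists a; rewrite -b0E.
have [k /asboolP[a Cak] kmin] := ex_minnP exk.
exists a => b Cb; have /uballs_stepsP[a' [k' bE]] := Cballs _ Cb.
rewrite {b}bE in Cb *.
have kk' : k <= k' by apply: kmin; apply/asboolP; exists a'.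
(* If the other ball lies inside the shortest one, [k <= k'] makes the two equal; so [a] belongs to
   it in either case. *)
by have [] := Ctot _ _ Cak Cb; rewrite segment_subset ?leq_addr // /segment /=;
  lia.
Qed.

Lemma steps_no_expansion (B' : set (set nat)) :
  uballs steps `<=` B' -> chain_union_closed B' -> ~ spherically_complete B'.
Proof.
move=> uB' B'U B'sc; pose ray n : set nat := [set z | n <= z].
have B'ray n : B' (ray n).
  have -> : ray n = \bigcup_(b in range (fun k => segment n (n + k))) b.
    apply/seteqP; split=> z.
      move=> nz; exists (segment n (n + (z - n))); first by exists (z - n).
      by move: nz; rewrite /ray /segment /=; lia.
    by move=> [_ [k _ <-]] /andP[].
  apply: B'U; split.
  - by exists (segment n (n + 0)), 0.
  - by move=> _ [k _ <-]; apply: uB'; apply/uballs_stepsP; exists n, k.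
  (* Segments with a common left end are nested according to length. *)
  - by move=> _ _ [k _ <-] [l _ <-]; rewrite !segment_subset ?leq_addr //; lia.
have [|z zrays] := B'sc (range ray).
  split.
  - by exists (ray 0), 0.
  - by move=> _ [n _ <-]; exact: B'ray.
  - move=> _ _ [m _ <-] [n _ <-]; have [mn|/ltnW nm] := leqP m n.
      by right=> z; exact: leq_trans.
    by left=> z; exact: leq_trans.
(* A point [z] common to all rays would lie in the ray that starts just after it. *)
have : ray z.+1 z by apply: zrays; exists z.+1.
by rewrite /ray /= ltnn.
Qed.

Theorem theorem1p4 :
  exists (d : Order.disp_t) (Gamma : bPOrderType d) (X : Type)
         (u : X -> X -> Gamma),
    [/\ ultrametric_space u,
        countable [set: X],
        countable [set: Gamma],
        spherically_complete (uballs u)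
      & ~ exists B' : set (set X),
            [/\ expansion (uballs u) B',
                chain_union_closed B'
              & spherically_complete B']].
Proof.
exists _, {fset nat}, nat, steps; split.
- exact: steps_ultrametric.
- exact: countableP.
- exact: countableP.
- exact: steps_spherically_complete.
- by move=> [B' [[_ uB'] B'U]]; exact: steps_no_expansion.
Qed.
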